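(* Let $\mathscr{A},\mathscr{B}$ be unital $C^*$-algebras and let $\Phi:\mathscr{A}\to\mathscr{B}$ be a (not necessarily linear) $3$-positive map. Then $$2\Phi(0)+\Phi(A+B)\geq \Phi(A)+\Phi(B)$$ for all positive elements $A,B\in\mathscr{A}$. In particular, $\Phi(0)=0$ if and only if $\Phi(A+B)\geq\Phi(A)+\Phi(B)$ for all positive elements $A,B\in\mathscr{A}$.
   Context: Maps between $C^*$-algebras are arbitrary functions; neither linearity nor continuity is assumed. $\leq$ is the usual order on self-adjoint elements. A map is positive if it sends positive elements to positive elements. $\Phi$ is $n$-positive if the entrywise map $\Phi_n:M_n(\mathscr{A})\to M_n(\mathscr{B})$, $\Phi_n([a_{ij}])=[\Phi(a_{ij})]$, is positive, where $M_n(\mathscr{A})$ is the $C^*$-algebra of $n\times n$ matrices over $\mathscr{A}$. *)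

(* Defs.v *)
From HB Require Import structures.
From mathcomp Require Import all_boot all_order all_algebra all_reals.
From mathcomp Require Import classical_sets.
From mathcomp.real_closed Require Import complex.

Set Implicit Arguments.
Unset Strict Implicit.
Unset Printing Implicit Defensive.

Import Order.TTheory GRing.Theory Num.Theory.

Local Open Scope classical_set_scope.
Local Open Scope ring_scope.

(* Unital *-algebras over C. The C-algebra structure is given by a ring
   morphism [cscal] into the centre, the scaling being l x := cscal l * x.
   [algType] is avoided because it sits above [nzRingType], which excludes the
   zero algebra and matrices of generic size n. *)
HB.mixin Record isStarAlgebra (C : numClosedFieldType) A of GRing.PzRing A := {
  cscal : {rmorphism C -> A};
  cscalC : forall (l : C) (x : A), cscal l * x = x * cscal l;
  star : A -> A;
  starK : forall x : A, star (star x) = x;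
  starD : forall x y : A, star (x + y) = star x + star y;
  starM : forall x y : A, star (x * y) = star y * star x;
  star_cscal : forall l : C, star (cscal l) = cscal l^*
}.

#[short(type="starAlgType")]
HB.structure Definition StarAlgebra (C : numClosedFieldType) :=
  {A of isStarAlgebra C A & GRing.PzRing A}.

(* The norm is a field of its own since joining [normedModType] with a ring
   structure is not compatible with the existing hierarchy, where
   [numDomainType] is the join of rings and normed groups. *)
HB.mixin Record StarAlgebra_isCStar (R : realType) A of StarAlgebra R[i] A := {
  cnorm : A -> R;
  cnormD : forall x y : A, cnorm (x + y) <= cnorm x + cnorm y;
  cnormZ : forall (l : R[i]) (x : A),
    cnorm (cscal l * x) = complex.Re `|l| * cnorm x;
  cnorm0_eq0 : forall x : A, cnorm x = 0 -> x = 0;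
  cnormM : forall x y : A, cnorm (x * y) <= cnorm x * cnorm y;
  cnorm_star : forall x : A, cnorm (star x * x) = cnorm x ^+ 2;
  cnorm_complete : forall u : nat -> A,
    (forall e : R, 0 < e -> exists N, forall m n : nat,
       (N <= m)%N -> (N <= n)%N -> cnorm (u m - u n) < e) ->
    exists l : A, forall e : R, 0 < e -> exists N, forall n : nat,
       (N <= n)%N -> cnorm (u n - l) < e
}.

#[short(type="cstarAlgType")]
HB.structure Definition CStarAlgebra (R : realType) :=
  {A of StarAlgebra_isCStar R A & StarAlgebra R[i] A}.

Section Positivity.
Variables (C : numClosedFieldType) (A : starAlgType C).
Implicit Types a b : A.

Definition invertible a : Prop := exists b, a * b = 1 /\ b * a = 1.

Definition spectrum a : set C := [set l | ~ invertible (cscal l - a)].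

Definition selfadjoint a : Prop := star a = a.

(* For l : C, [0 <= l] says that l is real and nonnegative. *)
Definition positive a : Prop :=
  selfadjoint a /\ spectrum a `<=` [set l | 0 <= l].

Definition sa_le a b : Prop :=
  [/\ selfadjoint a, selfadjoint b & positive (b - a)].

End Positivity.

(* Positivity in M_n(A) only depends on its *-algebra structure, so the
   (unique) C*-norm of M_n(A) is not constructed. *)
Section StarMatrix.
Variables (C : numClosedFieldType) (A : starAlgType C) (n : nat).
Local Notation M := 'M[A]_n.

Definition mx_cscal (l : C) : M := (cscal l)%:M.

Fact mx_cscal_is_zmod_morphism : zmod_morphism mx_cscal.
Proof. by move=> l m; rewrite /mx_cscal !raddfB. Qed.

Fact mx_cscal_is_monoid_morphism : monoid_morphism mx_cscal.
Proof.
by split=> [|l m]; rewrite /mx_cscal ?rmorph1 // rmorphM [LHS]scalar_mxM.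
Qed.

HB.instance Definition _ :=
  GRing.isZmodMorphism.Build C M mx_cscal mx_cscal_is_zmod_morphism.
HB.instance Definition _ :=
  GRing.isMonoidMorphism.Build C M mx_cscal mx_cscal_is_monoid_morphism.

Definition mx_star (X : M) : M := \matrix_(i, j) star (X j i).

Fact mx_cscalC (l : C) (X : M) : mx_cscal l * X = X * mx_cscal l.
Proof.
apply/matrixP => i j; rewrite /mx_cscal [LHS]mxE [RHS]mxE.
rewrite (bigD1 i) //= [RHS](bigD1 j) //= !mxE !eqxx !mulr1n cscalC.
rewrite !big1 // => k /negPf kN; rewrite !mxE ?kN ?mulr0n ?mulr0 //.
by rewrite eq_sym kN mulr0n mul0r.
Qed.

Fact mx_starK (X : M) : mx_star (mx_star X) = X.
Proof. by apply/matrixP => i j; rewrite !mxE starK. Qed.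

Fact mx_starD (X Y : M) : mx_star (X + Y) = mx_star X + mx_star Y.
Proof. by apply/matrixP => i j; rewrite !mxE starD. Qed.

Let star0 : star 0 = 0 :> A.
Proof. by apply: (addrI (star 0)); rewrite -starD !addr0. Qed.

Fact mx_starM (X Y : M) : mx_star (X * Y) = mx_star Y * mx_star X.
Proof.
apply/matrixP => i j; rewrite [RHS]mxE 2!mxE.
rewrite (big_morph _ (@starD C A) star0).
by apply: eq_bigr => k _; rewrite starM !mxE.
Qed.

Fact mx_star_cscal (l : C) : mx_star (mx_cscal l) = mx_cscal l^*.
Proof.
apply/matrixP => i j; rewrite /mx_cscal !mxE eq_sym.
by case: eqP => _; rewrite ?mulr1n ?mulr0n ?star_cscal ?star0.
Qed.

HB.instance Definition _ := isStarAlgebra.Build C M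
  mx_cscalC mx_starK mx_starD mx_starM mx_star_cscal.

End StarMatrix.

Definition n_positive (C : numClosedFieldType) (A B : starAlgType C) (n : nat)
    (Phi : A -> B) : Prop :=
  forall X : 'M[A]_n, positive X -> positive (map_mx Phi X).

(* Main.v *)
Require Import Defs.
From mathcomp Require Import all_boot all_order all_algebra all_reals.
From mathcomp.real_closed Require Import complex.
From HB Require Import structures.
From mathcomp Require Import boolp classical_sets ring lra.
From Stdlib Require Import Setoid.
From Stdlib Require Ncring Ncring_tac.

(** For positive [a] and [b], put [v = (1,1,0)] and [w = (1,0,1)]. The matrix
    [[
      X = star v a v + star w b w = [ a+b  a  b ]
                                    [  a   a  0 ]
                                    [  b   0  b ]
    ]]
    is positive, hence so is its entrywise image under [Phi]. Compressing that
    image by the column [c = (1,-1,-1)] gives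
    [star c (Phi X) c = Phi (a + b) - Phi a - Phi b + 2 Phi 0], which is the
    inequality. Conversely, superadditivity at [a = b = 0] says that [- Phi 0]
    is positive; as [Phi 0] is positive too, it vanishes.

    What has to be justified is that matrix positivity, defined by the spectrum
    in [M_n(A)], survives sums and the sandwiching [star V P V] with [V]
    rectangular ([mx_positiveD], [mx_positive_sandwich]). The proof combines two
    facts.

    Square roots ([sqrt_of_invertible]). In a Banach algebra with isometric
    involution, if [a] is selfadjoint and [a + s] is invertible for all [s > 0],
    then each [a + s] is the square of a selfadjoint element. For large [s] this
    is the square root of [1 - x] with [x] small, obtained as a fixed point. As
    [s] decreases the property can only be lost where the inverse of [a + s]
    blows up. This applies to [A], and also to [M_n(A)] with the sum of the
    norms of the entries as norm.

    Invertibility of Gram matrices ([invertible_gram]). For every rectangular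
    [Y] over [A], [1 + star Y Y] is invertible. Adding the rows of [Y] one at a
    time reduces this, by rank-one updates of an inverse, to the invertibility
    of [1 + sum_i star x_i x_i] in [A] itself.

    If now [P] is positive, then [P + e = star Z Z] with [Z] selfadjoint, so for
    small [e] the element [star V P V + s] is a Gram matrix plus [s / 2], and is
    invertible.

    It remains to see that in a C*-algebra sums of positive elements
    ([positiveD]) and elements [star x x] ([positive_star_mul]) are positive.
    The first follows from the description of positivity by
    [cnorm (a - t) <= t] for large [t]. The second uses the descent for
    square roots again: a blow-up of the inverse of [star x x + s] is excluded
    because [z star z + star z z] is positive for every [z]. Functional calculus
    and the spectral radius formula are avoided throughout. *)

Set Implicit Arguments.
Unset Strict Implicit.
Unset Printing Implicit Defensive.

Import Order.TTheory GRing.Theory Num.Theory.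
Local Open Scope ring_scope.

(** * Invertible elements and real scalars *)

(** These instances make the normalisation tactic for noncommutative rings
    available, as [ring] needs commutativity. *)
#[local] Instance pzRing_ops (A : pzRingType) :
  @Ncring.Ring_ops A 0 1 (@GRing.add A) (@GRing.mul A) (fun x y => x - y)
    (@GRing.opp A) (@eq A) := {}.

#[local] Instance pzRing_Ring (A : pzRingType) :
  Ncring.Ring (Ro := pzRing_ops A).
Proof.
constructor; try typeclasses eauto;
  cbv [Algebra_syntax.equality Ncring.eq_notation Ncring.add_notation
    Algebra_syntax.addition Algebra_syntax.multiplication Ncring.mul_notation
    Algebra_syntax.zero Ncring.zero_notation Algebra_syntax.one
    Ncring.one_notation Algebra_syntax.opposite Ncring.opp_notation]; move=> *.
all: rewrite ?addrA ?mulrA ?mul1r ?mulr1 ?add0r ?mulrDl ?mulrDr ?subrr //.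
exact: addrC.
Qed.

Ltac ncring := Ncring_tac.non_commutative_ring.

Section Invertible.
Variables (C : numClosedFieldType) (A : starAlgType C).
Implicit Types a b x y : A.

Lemma invertible_cscal (l : C) : l != 0 -> invertible (cscal l : A).
Proof.
move=> l0; exists (cscal l^-1).
by rewrite -!rmorphM /= mulfV // mulVf // rmorph1.
Qed.

Lemma invertibleM a b : invertible a -> invertible b -> invertible (a * b).
Proof.
move=> [a' [aa' a'a]] [b' [bb' b'b]]; exists (b' * a'); split.
  by rewrite mulrA -(mulrA a) bb' mulr1.
by rewrite mulrA -(mulrA b') a'a mulr1.
Qed.

Lemma invertible_commMl a b :
  a * b = b * a -> invertible (a * b) -> invertible a.
Proof.
move=> ab [c [abc cab]].
have abc' : a * (b * c) = 1 by rewrite mulrA.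
have cba' : c * b * a = 1 by rewrite -mulrA -ab.
exists (b * c); split=> //.
by rewrite -[b * c]mul1r -{1}cba' -(mulrA _ a) abc' mulr1.
Qed.

(** Jacobson's trick: expanding geometric series formally suggests the inverse
    [1 - b c a], where [c] is the inverse of [1 + a b]. *)
Lemma invertible_jacobson a b :
  invertible (1 + a * b) -> invertible (1 + b * a).
Proof.
move=> [c [hr hl]]; exists (1 - b * c * a); split.
  have e : (1 + b * a) * b = b * (1 + a * b).
    by rewrite mulrDl mulrDr mul1r mulr1 mulrA.
  by rewrite mulrBr mulr1 !mulrA e -(mulrA b) hr mulr1 addrK.
have e : a * (1 + b * a) = (1 + a * b) * a.
  by rewrite mulrDl mulrDr mul1r mulr1 mulrA.
by rewrite mulrBl mul1r -(mulrA _ a) e mulrA -(mulrA b) hl mulr1 addrK.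
Qed.

Lemma star0 : star 0 = 0 :> A.
Proof. by apply: (addrI (star 0)); rewrite -starD !addr0. Qed.

Lemma starN a : star (- a) = - star a.
Proof. by apply: (addIr (star a)); rewrite -starD !addNr star0. Qed.

Lemma starB a b : star (a - b) = star a - star b.
Proof. by rewrite starD starN. Qed.

Lemma star1 : star 1 = 1 :> A.
Proof. by rewrite -(rmorph1 (@cscal C A)) star_cscal conjC1. Qed.

Lemma star_inv a b : star a = a -> a * b = 1 -> b * a = 1 -> star b = b.
Proof.
move=> sa ab ba; rewrite -[LHS]mulr1 -ab mulrA -{1}sa -starM.
by rewrite ab star1 mul1r.
Qed.

End Invertible.

Section RealScalars.
Variables (R : realType).

Definition rscal {A : starAlgType R[i]} (t : R) : A := cscal (real_complex R t).

HB.instance Definition _ (A : starAlgType R[i]) :=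
  GRing.RMorphism.copy (@rscal A) (cscal \o real_complex R).

Variable A : starAlgType R[i].
Implicit Types a b x y : A.

Lemma rscalC t x : rscal t * x = x * rscal t.
Proof. exact: cscalC. Qed.

Lemma star_rscal t : star (rscal t) = rscal t :> A.
Proof.
by rewrite star_cscal; rewrite /rscal conj_Creal // complex_real.
Qed.

Lemma invertible_rscal t : t != 0 -> invertible (rscal t : A).
Proof.
by move=> t0; apply: invertible_cscal; rewrite fmorph_eq0.
Qed.

Lemma rscalK t x : t != 0 -> rscal t * (rscal t^-1 * x) = x.
Proof. by move=> t0; rewrite mulrA -rmorphM mulfV // rmorph1 mul1r. Qed.

Lemma rscal_half x : rscal 2^-1 * (x + x) = x.
Proof.
rewrite mulrDr -mulrDl -rmorphD /=.
have -> : 2^-1 + 2^-1 = 1 :> R by lra.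
by rewrite rmorph1 mul1r.
Qed.

End RealScalars.

(** * Banach algebras with an isometric involution *)

(** A consequence of Bernoulli's inequality for [1 / q], in the form
    [q ^+ n * (1 + n (1 - q)) <= 1], which also makes sense for [q = 0]. *)
Lemma expr_lt_archi (R : realType) (q c e : R) :
  0 <= q < 1 -> 0 < e -> exists n, q ^+ n * c < e.
Proof.
move=> /andP[q0 q1] e0.
have bern n : q ^+ n * (1 + (1 - q) *+ n) <= 1.
  elim: n => [|n IH]; first by rewrite expr0 mulr0n addr0 mulr1.
  have qn : 0 <= q ^+ n by rewrite exprn_ge0.
  apply: le_trans IH; rewrite exprSr -mulrA ler_wpM2l // mulrSr.
  have : 0 <= (1 - q) *+ n by rewrite mulrn_wge0 // subr_ge0 ltW.
  nra.
have [c0|c0] := leP c 0; first by exists 0%N; rewrite expr0 mul1r; lra.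
pose n := Num.bound (c / (e * (1 - q))); exists n.
have ep : 0 < e * (1 - q) by rewrite mulr_gt0 // subr_gt0.
have hn : c < (e * (1 - q)) * n%:R.
  rewrite mulrC -ltr_pdivrMr //.
  by apply: archi_boundP; rewrite divr_ge0 // ltW.
have := bern n; rewrite -mulr_natr => hb.
have qn : 0 <= q ^+ n by rewrite exprn_ge0.
have [->|qn0] := eqVneq (q ^+ n) 0; first by rewrite mul0r.
have {}qn0 : 0 < q ^+ n by rewrite lt_def qn0.
have : q ^+ n * c < q ^+ n * ((e * (1 - q)) * n%:R) by rewrite ltr_pM2l.
move=> h; apply: (lt_le_trans h).
have -> : q ^+ n * (e * (1 - q) * n%:R) = e * (q ^+ n * ((1 - q) * n%:R)).
  by ring.
rewrite -[leRHS]mulr1 ler_pM2l //; apply: le_trans hb.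
by rewrite ler_pM2l // lerDr.
Qed.

Section BanachStar.
Variables (R : realType) (A : starAlgType R[i]).

(** The C*-identity is not imposed, so that the sum of the norms of the entries
    is an example on matrices, although it is not a C*-norm in general. *)
Record banach_star_norm (N : A -> R) : Prop := BanachStarNorm {
  bnormD : forall x y, N (x + y) <= N x + N y;
  bnormZ : forall (l : R[i]) x, N (cscal l * x) = complex.Re `|l| * N x;
  bnorm0_eq0 : forall x, N x = 0 -> x = 0;
  bnormM : forall x y, N (x * y) <= N x * N y;
  bnorm_star : forall x, N (star x) = N x;
  bnorm_complete : forall u : nat -> A,
    (forall e : R, 0 < e -> exists K, forall m n : nat,
       (K <= m)%N -> (K <= n)%N -> N (u m - u n) < e) ->
    exists l : A, forall e : R, 0 < e -> exists K, forall n : nat,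
       (K <= n)%N -> N (u n - l) < e
}.

Definition is_square (a : A) : Prop := exists2 b, selfadjoint b & b * b = a.

Variable N : A -> R.
Hypothesis hN : banach_star_norm N.
Implicit Types (a b x y : A) (e q s t : R).

Lemma bnormZr t x : N (rscal t * x) = `|t| * N x.
Proof.
rewrite (bnormZ hN) normc_def /= expr0n /= addr0; congr (_ * _).
exact: sqrtr_sqr.
Qed.

Lemma bnorm0 : N 0 = 0.
Proof. by rewrite -(mul0r 0) -(rmorph0 (@rscal R A)) bnormZr normr0 mul0r. Qed.

Lemma bnormN x : N (- x) = N x.
Proof.
have -> : - x = rscal (-1) * x by rewrite rmorphN rmorph1 mulN1r.
by rewrite bnormZr normrN normr1 mul1r.
Qed.

Lemma bnorm_ge0 x : 0 <= N x.
Proof.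
by have := bnormD hN x (- x); rewrite subrr bnorm0 bnormN; lra.
Qed.

Lemma bnormBC x y : N (x - y) = N (y - x).
Proof. by rewrite -bnormN opprB. Qed.

Lemma bnormB x y : N (x - y) <= N x + N y.
Proof. by rewrite -(bnormN y) (bnormD hN). Qed.

Lemma bnorm_tri z x y : N (x - y) <= N (x - z) + N (z - y).
Proof. by apply: le_trans (bnormD hN _ _); rewrite addrA subrK. Qed.

Lemma bnorm_lim0 c x : (forall e, 0 < e -> N x <= c * e) -> x = 0.
Proof.
move=> h; apply: (bnorm0_eq0 hN); apply/eqP; rewrite eq_le bnorm_ge0 andbT.
apply/ler_addgt0Pr => e e0; rewrite add0r.
have c0 : 0 < `|c| + 1 by rewrite ltr_wpDl.
apply: le_trans (h (e / (`|c| + 1)) _) _; first by rewrite divr_gt0.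
rewrite mulrA ler_pdivrMr // mulrC ler_pM2l //.
by rewrite (le_trans (ler_norm c)) // lerDl.
Qed.

(** Banach's fixed point theorem on a closed set [S], which records algebraic
    properties (selfadjointness, commutation) that pass to the limit. *)
Lemma contraction_fixpoint (S : A -> Prop) (F : A -> A) q y0 :
    0 <= q < 1 -> S y0 -> (forall y, S y -> S (F y)) ->
    (forall x y, S x -> S y -> N (F x - F y) <= q * N (x - y)) ->
    (forall l, (forall e, 0 < e -> exists2 y, S y & N (y - l) < e) -> S l) ->
  exists2 y, S y & F y = y.
Proof.
move=> q01 S0 SF Fq Scl; pose u n := iter n F y0.
have q0 : 0 <= q by case/andP: q01.
have Su n : S (u n) by elim: n => //= n; exact: SF.
have step n : N (u n.+1 - u n) <= q ^+ n * N (F y0 - y0).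
  elim: n => [|n IH]; first by rewrite expr0 mul1r.
  apply: le_trans (Fq _ _ (Su n.+1) (Su n)) _.
  by rewrite exprS -mulrA ler_wpM2l.
set d := N _ in step.
have d0 : 0 <= d by exact: bnorm_ge0.
pose c := d / (1 - q).
have q1 : 0 < 1 - q by rewrite subr_gt0; case/andP: q01.
have c0 : 0 <= c by rewrite divr_ge0 // ltW.
have cE : d = c * (1 - q) by rewrite divfK // gt_eqF.
have tail n k : N (u (n + k)%N - u n) <= (q ^+ n - q ^+ (n + k)) * c.
  elim: k => [|k IH]; first by rewrite addn0 !subrr mul0r bnorm0.
  rewrite addnS; apply: le_trans (bnorm_tri (u (n + k)%N) _ _) _.
  apply: le_trans (lerD (step _) IH) _.
  by rewrite cE exprS le_eqVlt; apply/orP; left; apply/eqP; ring.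
have tail' K n : (K <= n)%N -> N (u n - u K) <= q ^+ K * c.
  move=> Kn; rewrite -(subnKC Kn); apply: le_trans (tail _ _) _.
  by rewrite ler_wpM2r // gerBl exprn_ge0.
have [l hl] : exists l : A, forall e : R, 0 < e -> exists K, forall n : nat,
       (K <= n)%N -> N (u n - l) < e.
  apply: (bnorm_complete hN) => e e0.
  have [K hK] := expr_lt_archi (c *+ 2) q01 e0.
  exists K => m n Km Kn; apply: le_lt_trans hK.
  apply: le_trans (bnorm_tri (u K) _ _) _.
  by rewrite mulr2n mulrDr lerD ?tail' // bnormBC tail'.
have Sl : S l.
  apply: Scl => e e0; have [K hK] := hl e e0.
  by exists (u K) => //; exact: hK.
exists l => //; apply/eqP; rewrite -subr_eq0; apply/eqP.
apply: (@bnorm_lim0 (q + 1)) => e e0; have [K hK] := hl e e0.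
apply: le_trans (bnorm_tri (u K.+1) _ _) _.
rewrite mulrDl mul1r lerD //; last exact/ltW/hK/leqW.
apply: le_trans (Fq _ _ Sl (Su K)) _.
by rewrite ler_wpM2l // bnormBC ltW // hK.
Qed.

(** Left and right inverses are the fixed points of [y |-> 1 + y x] and
    [y |-> 1 + x y]. *)
Lemma neumann x : N x < 1 -> invertible (1 - x).
Proof.
move=> x1.
have q01 : 0 <= N x < 1 by rewrite bnorm_ge0.
have fixpoint (F : A -> A) :
    (forall y z, N (F y - F z) <= N x * N (y - z)) -> exists y, F y = y.
  move=> hF.
  have [y _ yE] : exists2 y, True & F y = y; last by exists y.
  by apply: (@contraction_fixpoint (fun=> True) F (N x) 0) => // y z _ _.
have [y yE] : exists y, 1 + x * y = y.
  apply: (fixpoint (fun y => 1 + x * y)) => y z.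
  by rewrite opprD addrACA subrr add0r -mulrBr (bnormM hN).
have [z zE] : exists z, 1 + z * x = z.
  apply: (fixpoint (fun y => 1 + y * x)) => y' z.
  by rewrite opprD addrACA subrr add0r -mulrBl [leRHS]mulrC (bnormM hN).
have ry : (1 - x) * y = 1 by rewrite mulrBl mul1r -{1}yE addrK.
have lz : z * (1 - x) = 1 by rewrite mulrBr mulr1 -{1}zE addrK.
exists y; split=> //.
suff <- : z = y by [].
by rewrite -[z]mulr1 -ry mulrA lz mul1r.
Qed.

(** Writing the root as [1 - y], the equation [(1 - y)^2 = 1 - x] becomes
    [y = (x + y^2) / 2], whose right-hand side is a contraction of ratio [N x]
    on the ball of radius [N x]. The root commutes with whatever commutes with
    [x] because this holds for all iterates. *)
Lemma sqrt_one_minus x : selfadjoint x -> N x < 1 ->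
  exists c, [/\ selfadjoint c, c * c = 1 - x &
    forall z, z * x = x * z -> z * c = c * z].
Proof.
move=> sx x1; set q := N x.
have q01 : 0 <= q < 1 by rewrite bnorm_ge0.
have q0 : 0 <= q by case/andP: q01.
have h2 : `|2^-1 : R| = 2^-1 by rewrite ger0_norm ?invr_ge0.
pose S y :=
  [/\ selfadjoint y, N y <= q & forall z, z * x = x * z -> z * y = y * z].
pose F y := rscal 2^-1 * (x + y * y) : A.
have [y [sy _ cy] yE] : exists2 y, S y & F y = y.
  apply: (@contraction_fixpoint S F q 0 q01).
  - split; rewrite /selfadjoint ?star0 ?bnorm0 // => z _.
    by rewrite mulr0 mul0r.
  - move=> y [sy yq cy]; split.
    + by rewrite /selfadjoint /F starM star_rscal starD starM sx sy rscalC.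
    + rewrite bnormZr h2; have := bnormD hN x (y * y); rewrite -/q => h.
      have := bnormM hN y y.
      have : N y * N y <= q * q by rewrite ler_pM ?bnorm_ge0.
      case/andP: q01 => _ hq; nra.
    + move=> z hz; rewrite /F mulrA -rscalC -!mulrA; congr (_ * _).
      by rewrite mulrDl mulrDr hz mulrA (cy z hz) -!mulrA (cy z hz).
  - move=> y z [_ yq _] [_ zq _].
    have -> : F y - F z = rscal 2^-1 * (y * (y - z) + (y - z) * z).
      by rewrite /F -mulrBr; congr (_ * _); ncring.
    rewrite bnormZr h2; have := bnormD hN (y * (y - z)) ((y - z) * z).
    have := bnormM hN y (y - z); have := bnormM hN (y - z) z.
    have := bnorm_ge0 (y - z).
    set d := N (y - z) => d0; nra.
  - move=> l hl; split.
    + apply/eqP; rewrite -subr_eq0; apply/eqP.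
      apply: (@bnorm_lim0 2) => e /hl[y [sy _ _] yl].
      apply: le_trans (bnorm_tri y _ _) _.
      rewrite -{1}sy -starB (bnorm_star hN) bnormBC; lra.
    + apply/ler_addgt0Pr => e /hl[y [_ yq _] yl].
      have := bnormD hN (l - y) y; rewrite subrK bnormBC; lra.
    + move=> z hz; apply/eqP; rewrite -subr_eq0; apply/eqP.
      apply: (@bnorm_lim0 (N z *+ 2)) => e /hl[y [_ _ cy] yl].
      have -> : z * l - l * z = z * (l - y) - (l - y) * z.
        by rewrite mulrBr mulrBl (cy z hz); ncring.
      apply: le_trans (bnormB _ _) _.
      have := bnormM hN z (l - y); have := bnormM hN (l - y) z.
      have := bnorm_ge0 z; rewrite (bnormBC l y); set a := N (y - l) in yl *.
      move=> z0; have : N z * a <= N z * e by rewrite ler_wpM2l // ltW.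
      lra.
have {}yE : x + y * y = y + y.
  by rewrite -[in RHS]yE /F -mulrDr rscal_half.
exists (1 - y); split.
- by rewrite /selfadjoint starB star1 sy.
- have -> : x = y + y - y * y by rewrite -yE addrK.
  ncring.
- by move=> z /cy hz; rewrite mulrBr mulrBl hz mulr1 mul1r.
Qed.
End BanachStar.

(** * Square roots by descent *)

Section SquareRoots.
Variables (R : realType) (A : starAlgType R[i]) (N : A -> R).
Hypothesis hN : banach_star_norm N.
Implicit Types (a b x y : A) (e s t : R).

Lemma sqrt_shift a s : selfadjoint a -> N a < s ->
  exists b, [/\ selfadjoint b, b * b = a + rscal s &
    forall z, z * a = a * z -> z * b = b * z].
Proof.
move=> sa as_.
have s0 : 0 < s by apply: le_lt_trans as_; exact: bnorm_ge0 hN _.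
have [||c [sc cc hc]] := sqrt_one_minus hN (x := - (rscal s^-1 * a)).
- by rewrite /selfadjoint starN starM star_rscal sa rscalC.
- rewrite (bnormN hN) (bnormZr hN) gtr0_norm ?invr_gt0 // mulrC.
  by rewrite ltr_pdivrMr // mul1r.
exists (rscal (Num.sqrt s) * c); split.
- by rewrite /selfadjoint starM star_rscal sc rscalC.
- rewrite mulrA -(mulrA _ c) -(rscalC _ c) mulrA -rmorphM -mulrA cc.
  rewrite -expr2 sqr_sqrtr ?ltW // opprK mulrDr mulr1 rscalK ?gt_eqF //.
  exact: addrC.
- move=> z hz; rewrite mulrA -rscalC -!mulrA hc //.
  by rewrite mulrN mulNr mulrA -rscalC -!mulrA hz.
Qed.

Lemma is_square_shift a s : selfadjoint a -> N a < s -> is_square (a + rscal s).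
Proof. by move=> sa /(sqrt_shift sa)[b [sb bb _]]; exists b. Qed.

(** The set of invertible squares is open along the real axis, with a radius
    controlled by the inverse: [b^2 - t = b (1 - t r) b], where [1 - t r] has a
    root commuting with [b]. *)
Lemma is_square_subr a r t : is_square a -> a * r = 1 -> r * a = 1 -> 0 <= t ->
  t * N r < 1 -> is_square (a - rscal t).
Proof.
move=> [b sb bE] ar ra t0 tr.
have sa : star a = a by rewrite -bE starM sb.
have sr := star_inv sa ar ra.
have br : b * r = r * b.
  rewrite -[LHS]mul1r -ra -mulrA (mulrA a) -bE -(mulrA b b b) bE -(mulrA b) ar.
  by rewrite mulr1.
have [||c [sc cc hc]] := sqrt_one_minus hN (x := rscal t * r).
- by rewrite /selfadjoint starM star_rscal sr rscalC.
- by rewrite (bnormZr hN) ger0_norm.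
have bc : b * c = c * b.
  by apply: hc; rewrite mulrA -rscalC -mulrA br mulrA.
exists (b * c); first by rewrite /selfadjoint starM sb sc.
rewrite {2}bc mulrA -(mulrA b) cc.
have -> : b * (1 - rscal t * r) * b = b * b - b * (rscal t * (r * b)) by ncring.
by rewrite mulrA -rscalC -br -mulrA (mulrA b) bE ar mulr1.
Qed.

(** Let [m] be the supremum of the [s > 0] for which [a + s] is not a square.
    Just above [m] the inverses are bounded by [rho], so by [is_square_subr]
    squares persist on an interval of length about [1 / rho] below such points,
    which goes past [m]. *)
Lemma sqrt_descent a : selfadjoint a ->
    (forall m, 0 < m -> (forall s, m < s -> is_square (a + rscal s)) ->
      exists rho e, 0 < e /\ forall s, m < s < m + e ->
        exists r,
          [/\ (a + rscal s) * r = 1, r * (a + rscal s) = 1 & N r <= rho]) ->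
  forall s, 0 < s -> is_square (a + rscal s).
Proof.
move=> sa H s1 s1_gt0; apply: contrapT => ns1.
pose D : set R := [set s | 0 < s /\ ~ is_square (a + rscal s)]%classic.
have Ds1 : D s1 by [].
have ubD : has_ubound D.
  exists (N a) => s [_ ns]; rewrite leNgt; apply/negP => /(is_square_shift sa).
  exact: ns.
have supD : has_sup D by split=> //; exists s1.
set m := sup D.
have m0 : 0 < m by apply: lt_le_trans s1_gt0 _; exact: ub_le_sup.
have sqm s : m < s -> is_square (a + rscal s).
  move=> ms; apply: contrapT => ns.
  have : s <= m by apply: ub_le_sup => //; split=> //; exact: lt_trans ms.
  by rewrite leNgt ms.
have [rho [e [e0 he]]] := H m m0 sqm.
(* From m + d one can descend by 1 / (|rho| + 1), which is at least 2 d, and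
   so reach every point above m - d. *)
pose d := Num.min (e / 2) (2^-1 / (`|rho| + 1)).
have r0 : 0 < `|rho| + 1 by rewrite ltr_wpDl.
have d0 : 0 < d by rewrite lt_min !divr_gt0 // invr_gt0.
have de : d <= e / 2 by rewrite ge_min lexx.
have dr : d * (`|rho| + 1) <= 2^-1.
  by rewrite -ler_pdivlMr // ge_min lexx orbT.
have [s' [s'0 ns'] ms'] := sup_adherent d0 supD; rewrite -/m in ms'.
have s'm : s' <= m by apply: ub_le_sup.
have [|r [hr hl rrho]] := he (m + d); first by apply/andP; split; lra.
apply: ns'.
have -> : a + rscal s' = (a + rscal (m + d)) - rscal (m + d - s').
  by rewrite -addrA -rmorphB; congr (_ + rscal _); ring.
apply: is_square_subr hr hl _ _; [by apply: sqm; lra|lra|].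
have := ler_norm rho; have := bnorm_ge0 hN r.
move=> h1 h2; have : (m + d - s') * N r <= (2 * d) * `|rho|.
  by apply: ler_pM; lra.
nra.
Qed.

(** If [a + m] is invertible with inverse [r0], the resolvent identity bounds
    the inverses of the nearby [a + s] by [2 N r0]. *)
Lemma sqrt_of_invertible a : selfadjoint a ->
    (forall s, 0 < s -> invertible (a + rscal s)) ->
  forall s, 0 < s -> is_square (a + rscal s).
Proof.
move=> sa ia; apply: sqrt_descent => // m m0 _.
have [r0 [h1 h2]] := ia m m0.
have n0 := bnorm_ge0 hN r0.
exists (2 * N r0), (2^-1 / (N r0 + 1)); split.
  by rewrite divr_gt0 ?invr_gt0 // ltr_wpDl.
move=> s /andP[ms se]; have [r [hr hl]] := ia s (lt_trans m0 ms).
exists r; split=> //.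
have rE : r = r0 - r0 * (rscal (s - m) * r).
  rewrite -{1}[r0]mulr1 -hr -mulrBr rmorphB.
  have -> : (a + rscal s) * r - (rscal s - rscal m) * r = (a + rscal m) * r.
    by rewrite -mulrBl; congr (_ * _); ncring.
  by rewrite mulrA h2 mul1r.
have hr' : N r <= N r0 + N r0 * ((s - m) * N r).
  rewrite {1}rE; apply: le_trans (bnormB hN _ _) _; rewrite lerD2l.
  apply: le_trans (bnormM hN _ _) _; rewrite (bnormZr hN) gtr0_norm // subr_gt0.
  exact: ms.
have hs : (s - m) * (N r0 + 1) <= 2^-1.
  by rewrite -ler_pdivlMr ?ltr_wpDl //; lra.
have nr := bnorm_ge0 hN r.
have : N r0 * (s - m) <= 2^-1 by nra.
nra.
Qed.

End SquareRoots.

(** * Positivity in symmetric star-algebras *)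

Section SymmetricAlgebra.
Variables (R : realType) (A : starAlgType R[i]).
Implicit Types (a b x y z : A) (e s t : R).

Definition iscal : A := cscal 'i%C.

Lemma iscalC x : iscal * x = x * iscal. Proof. exact: cscalC. Qed.

Lemma iscal_sq : iscal * iscal = -1.
Proof.
rewrite -rmorphM; have -> : 'i%C * 'i%C = -1 :> R[i].
  apply/eqP; rewrite eq_complex /=.
  by rewrite !mul0r !mulr1 !mulr0 sub0r addr0 oppr0 !eqxx.
by rewrite rmorphN rmorph1.
Qed.

Lemma star_iscal : star iscal = - iscal.
Proof.
rewrite star_cscal -rmorphN; congr (cscal _).
by apply/eqP; rewrite eq_complex /= oppr0 !eqxx.
Qed.

Lemma cscal_rect (l : R[i]) :
  cscal l = rscal (complex.Re l) + iscal * rscal (complex.Im l) :> A.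
Proof. by rewrite {1}[l]complexE rmorphD rmorphM. Qed.

Lemma selfadjoint_shift a s : selfadjoint a -> selfadjoint (a + rscal s).
Proof. by move=> sa; rewrite /selfadjoint starD sa star_rscal. Qed.

Lemma invertible_scale s a : s != 0 -> invertible a -> invertible (rscal s * a).
Proof. by move=> s0 ia; apply: invertibleM => //; exact: invertible_rscal. Qed.

Lemma invertible_opp a : invertible a -> invertible (- a).
Proof. by move=> [b [h1 h2]]; exists (- b); rewrite !mulrNN. Qed.

Lemma invertible_jacobson_shift t x y : t != 0 ->
  invertible (rscal t - x * y) -> invertible (rscal t - y * x).
Proof.
move=> t0 h.
have e u v : rscal t - u * v = rscal t * (1 + (rscal t^-1 * - u) * v) :> A.
  by rewrite mulrDr mulr1 -mulrA rscalK // mulNr.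
rewrite e; apply: invertible_scale => //.
rewrite mulrN mulNr -mulrA rscalC -mulrA -[_ * rscal _]rscalC -mulrN.
apply: invertible_jacobson.
have -> : 1 + - (rscal t^-1 * x) * y = rscal t^-1 * (rscal t - x * y).
  by rewrite mulrBr -rmorphM mulVf // rmorph1 mulrA mulNr.
by apply: invertible_scale; rewrite ?invr_eq0.
Qed.

(** Equivalently, selfadjoint elements have real spectrum. *)
Definition star_symmetric :=
  forall a s, selfadjoint a -> 0 < s -> invertible (a * a + rscal s).

Lemma positive_invertible a s :
  positive a -> 0 < s -> invertible (a + rscal s).
Proof.
move=> [_ sp] s0; apply: contrapT => ni.
have : spectrum a (real_complex R (- s)).
  move=> /= /invertible_opp; rewrite opprB => h; apply: ni.
  by move: h; rewrite -/(rscal (- s)) rmorphN opprK.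
by move=> /sp /=; rewrite lecR oppr_ge0 leNgt s0.
Qed.

Hypothesis symA : star_symmetric.

Lemma invertible_add_iscal a s : selfadjoint a -> s != 0 ->
  invertible (a + iscal * rscal s).
Proof.
move=> sa s0.
have e : a * a + rscal (s ^+ 2) = (a + iscal * rscal s) * (a - iscal * rscal s).
  rewrite mulrBr !mulrDl.
  have -> : a * (iscal * rscal s) = iscal * rscal s * a.
    by rewrite mulrA -iscalC -!mulrA rscalC.
  have -> : iscal * rscal s * (iscal * rscal s) = - rscal (s ^+ 2).
    rewrite -mulrA (mulrA (rscal s)) (rscalC s iscal) !mulrA iscal_sq -mulrA.
    by rewrite -rmorphM mulN1r expr2.
  ncring.
apply: (@invertible_commMl _ _ _ (a - iscal * rscal s)).
  have : (iscal * rscal s) * a = a * (iscal * rscal s).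
    by rewrite [RHS]mulrA -iscalC -!mulrA rscalC.
  set j := iscal * _ => ja.
  rewrite !mulrBr !mulrBl !mulrDl !mulrDr ja; ncring.
by rewrite -e; apply: symA; rewrite // exprn_even_gt0.
Qed.

(** Nonreal points of the spectrum are excluded by [invertible_add_iscal],
    applied after a real translation. *)
Lemma symmetric_positive a : selfadjoint a ->
  (forall s, 0 < s -> invertible (a + rscal s)) -> positive a.
Proof.
move=> sa ia; split=> // l /= nl; apply: contrapT => l0; apply: nl.
rewrite cscal_rect; have [im0|im0] := eqVneq (complex.Im l) 0.
  rewrite im0 rmorph0 mulr0 addr0.
  have re0 : complex.Re l < 0.
    rewrite ltNge; apply/negP => re0; apply: l0.
    by rewrite [l]complexE im0 mulr0 addr0 lecR.
  rewrite -opprB; apply: invertible_opp.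
  by rewrite -rmorphN; apply: ia; rewrite oppr_gt0.
set x := complex.Re l; set y := complex.Im l.
have -> : rscal x + iscal * rscal y - a =
    - ((a + rscal (- x)) + iscal * rscal (- y)) :> A.
  by rewrite !rmorphN; ncring.
apply: invertible_opp; apply: invertible_add_iscal; rewrite ?oppr_eq0 //.
exact: selfadjoint_shift.
Qed.

Lemma positive_scale a t : 0 < t -> positive a -> positive (rscal t * a).
Proof.
move=> t0 pa; have [sa _] := pa; apply: symmetric_positive.
  by rewrite /selfadjoint starM star_rscal sa rscalC.
move=> s s0; rewrite -[rscal s](rscalK _ (lt0r_neq0 t0)) -mulrDr -rmorphM.
apply: invertible_scale; first by rewrite gt_eqF.
by apply: positive_invertible => //; rewrite mulr_gt0 ?invr_gt0.
Qed.

Lemma square_positive b : selfadjoint b -> positive (b * b).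
Proof.
move=> sb; apply: symmetric_positive; first by rewrite /selfadjoint starM sb.
by move=> s; exact: symA.
Qed.

Lemma is_squares_positive a :
  (forall s, 0 < s -> is_square (a + rscal s)) -> positive a.
Proof.
move=> qa; apply: symmetric_positive.
  have [b sb bb] := qa 1 ltr01.
  rewrite -[a](addrK (rscal 1)) -bb /selfadjoint starB starM sb star_rscal.
  by [].
move=> s s0; have s2 : 0 < s / 2 by rewrite divr_gt0.
have [b sb bb] := qa _ s2.
have -> : rscal s = rscal (s / 2) + rscal (s / 2) :> A.
  by rewrite -rmorphD -splitr.
by rewrite addrA -bb; exact: symA.
Qed.

Lemma positive0 : positive (0 : A).
Proof. by rewrite -(mul0r 0); apply: square_positive; exact: star0. Qed.

End SymmetricAlgebra.
Arguments iscal {R A}.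

Lemma positive_is_square (R : realType) (A : starAlgType R[i]) (N : A -> R)
    (hN : banach_star_norm N) (a : A) (s : R) :
  positive a -> 0 < s -> is_square (a + rscal s).
Proof.
move=> pa; have [sa _] := pa.
by apply: (sqrt_of_invertible hN sa) => t; exact: positive_invertible.
Qed.

(** * Positivity in C*-algebras *)

Section CStar.
Variables (R : realType) (A : cstarAlgType R).
Implicit Types (a b x y z : A) (e s t : R).

Lemma cnorm_banach : banach_star_norm (@cnorm R A).
Proof.
have norm0 : cnorm (0 : A) = 0.
  by rewrite -(mul0r 0) -(rmorph0 cscal) cnormZ normr0 /= mul0r.
have normN x : cnorm (- x) = cnorm x.
  have -> : - x = cscal (-1) * x by rewrite rmorphN rmorph1 mulN1r.
  by rewrite cnormZ normrN normr1 /= mul1r.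
have norm_ge0 x : 0 <= cnorm x.
  by have := cnormD x (- x); rewrite subrr norm0 normN; lra.
have star_le x : cnorm x <= cnorm (star x).
  have [->|x0] := eqVneq (cnorm x) 0; first exact: norm_ge0.
  have xp : 0 < cnorm x by rewrite lt_def x0 norm_ge0.
  by rewrite -(ler_pM2r xp) -expr2 -cnorm_star cnormM.
split; [exact: cnormD|exact: cnormZ|exact: cnorm0_eq0|exact: cnormM|
        |exact: cnorm_complete].
by move=> x; apply/eqP; rewrite eq_le star_le andbT -{2}[x]starK star_le.
Qed.

Let hN := cnorm_banach.

Lemma cnorm1_le1 : cnorm (1 : A) <= 1.
Proof.
have := cnorm_star (1 : A); rewrite star1 mulr1 => h.
have := bnorm_ge0 hN (1 : A); nra.
Qed.

Lemma cnorm_rscal t : cnorm (rscal t : A) <= `|t|.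
Proof.
by rewrite -[rscal t]mulr1 (bnormZr hN) ler_piMr // cnorm1_le1.
Qed.

Lemma cnorm_iscal x : cnorm (iscal * x) = cnorm x.
Proof.
rewrite cnormZ normc_def /= expr0n /= add0r expr1n.
by rewrite sqrtr1 mul1r.
Qed.

Lemma star_add_iscal a b : selfadjoint a -> selfadjoint b ->
  star (a + iscal * b) = a - iscal * b.
Proof. by move=> sa sb; rewrite starD starM star_iscal sa sb mulrN iscalC. Qed.

Lemma star_mul_add_iscal a b :
  selfadjoint a -> selfadjoint b -> a * b = b * a ->
  star (a + iscal * b) * (a + iscal * b) = a * a + b * b.
Proof.
move=> sa sb ab; rewrite star_add_iscal // mulrDr !mulrBl.
have -> : a * (iscal * b) = iscal * b * a by rewrite mulrA -iscalC -!mulrA ab.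
have -> : iscal * b * (iscal * b) = - (b * b).
  by rewrite {1}iscalC -mulrA (mulrA iscal) iscal_sq mulN1r mulrN.
ncring.
Qed.

(** Arens' argument. Translating along the imaginary axis by [t] costs only
    [t^2] in the C*-norm squared: [cnorm (a + i t)^2 <= cnorm a^2 + t^2]. For a
    suitable [t] this is less than [(u - t)^2], and a Neumann series inverts
    [a + i u = (a + i t) + i (u - t)]. *)
Lemma cstar_symmetric : star_symmetric A.
Proof.
move=> a s sa s0; pose r := Num.sqrt s.
have r0 : 0 < r by rewrite sqrtr_gt0.
have key (u : R) : u != 0 -> invertible (a + iscal * rscal u).
  (* With this t one gets (u - t)^2 = u^2 + cnorm a ^ 2 + t^2. *)
  move=> u0; pose t := - cnorm a ^+ 2 / (2 * u); set w := u - t.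
  have tu : t * u = - cnorm a ^+ 2 / 2 by rewrite /t; field.
  have u2 : 0 < u ^+ 2 by rewrite exprn_even_gt0.
  pose x := a + iscal * rscal t.
  have hx : cnorm x ^+ 2 < w ^+ 2.
    rewrite -cnorm_star star_mul_add_iscal //; last 2 first.
    - exact: star_rscal.
    - by rewrite rscalC.
    apply: le_lt_trans (bnormD hN _ _) _; rewrite -rmorphM.
    have := bnormM hN a a; have := cnorm_rscal (t * t).
    rewrite ger0_norm -?expr2 ?sqr_ge0 // /w sqrrB; lra.
  have nx := bnorm_ge0 hN x.
  have w0 : w != 0.
    by apply/eqP => w0; move: hx; rewrite w0 expr0n ltNge sqr_ge0.
  have hxw : cnorm x < `|w|.
    by rewrite -(ltr_pXn2r (n := 2)) ?nnegrE // -normrX ger0_norm ?sqr_ge0.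
  have -> : a + iscal * rscal u =
      iscal * (rscal w * (1 - (rscal w^-1 * (iscal * x)))).
    rewrite mulrBr mulr1 rscalK // mulrBr mulrA iscal_sq mulN1r opprK /x.
    rewrite rmorphB mulrBr; ncring.
  apply: invertibleM; last apply: invertibleM.
  - by exists (- iscal); rewrite mulrN mulNr iscal_sq opprK.
  - exact: invertible_rscal.
  apply: (neumann hN); rewrite (bnormZr hN) cnorm_iscal normfV mulrC.
  by rewrite ltr_pdivrMr ?normr_gt0 // mul1r.
have -> : a * a + rscal s = (a - iscal * rscal r) * (a + iscal * rscal r).
  rewrite -star_add_iscal //; last exact: star_rscal.
  rewrite star_mul_add_iscal ?rscalC //; last exact: star_rscal.
  by rewrite -rmorphM -(expr2 r) sqr_sqrtr // ltW.
apply: invertibleM; last by apply: key; rewrite gt_eqF.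
by rewrite -mulrN -rmorphN; apply: key; rewrite oppr_eq0 gt_eqF.
Qed.

Let symA := cstar_symmetric.

(** With [u = a + i b], the norm of the real part [a] is at most [cnorm u], and
    [star u * u = a^2 + b^2]. *)
Lemma cnorm_sq_le_sum a b : selfadjoint a -> selfadjoint b -> a * b = b * a ->
  cnorm a ^+ 2 <= cnorm (a * a + b * b).
Proof.
move=> sa sb ab; rewrite -star_mul_add_iscal // cnorm_star.
set u := a + _.
have au : a = rscal 2^-1 * (u + star u).
  by rewrite star_add_iscal // /u addrACA subrr addr0 rscal_half.
have na : cnorm a <= cnorm u.
  rewrite {1}au (bnormZr hN) ger0_norm ?invr_ge0 //.
  have := bnormD hN u (star u); rewrite (bnorm_star hN); lra.
by rewrite ler_sqr ?nnegrE ?(bnorm_ge0 hN).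
Qed.

(** Together with [sqrt_of_cnorm_sub] this describes positivity by a condition
    on the norm that is visibly stable under addition. Up to a small [e],
    [a = b^2] and [t - a = d^2] with [d] commuting with [b], so
    [cnorm_sq_le_sum] bounds [d]. *)
Lemma positive_cnorm_sub a t :
  positive a -> cnorm a < t -> cnorm (a - rscal t) <= t.
Proof.
move=> pa at_; have sqa e := @positive_is_square _ _ _ hN a e pa.
apply/ler_addgt0Pr => e0 e0_gt0.
pose e := Num.min e0 ((t - cnorm a) / 2).
have ep : 0 < e by rewrite lt_min e0_gt0 divr_gt0 // subr_gt0.
have ee0 : e <= e0 by rewrite ge_min lexx.
have et : e <= (t - cnorm a) / 2 by rewrite ge_min lexx orbT.
have [b sb bb] := sqa e ep.
have n1 : cnorm (rscal e : A) <= e by rewrite -{2}(gtr0_norm ep) cnorm_rscal.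
have nb : cnorm (- (b * b)) < t.
  rewrite (bnormN hN) bb; have := bnormD hN a (rscal e); lra.
have sbb : selfadjoint (- (b * b)) by rewrite /selfadjoint starN starM sb.
have [d [sd dd dc]] := sqrt_shift hN sbb nb.
have bd : b * d = d * b by apply: dc; rewrite mulrN mulNr mulrA.
have nd : cnorm d ^+ 2 <= t.
  apply: le_trans (cnorm_sq_le_sum sd sb _) _ => //.
  rewrite dd addrAC addNr add0r.
  apply: le_trans (cnorm_rscal t) _; rewrite ger0_norm //.
  exact: le_trans (bnorm_ge0 hN _) (ltW nb).
have -> : a - rscal t = - (d * d) - rscal e.
  rewrite dd bb; ncring.
apply: le_trans (bnormB hN _ _) _; rewrite (bnormN hN).
by apply: lerD; [apply: le_trans (bnormM hN _ _) _; rewrite -expr2|lra].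
Qed.

Lemma sqrt_of_cnorm_sub a t e :
  selfadjoint a -> cnorm (a - rscal t) <= t -> 0 < e ->
  exists b, [/\ selfadjoint b, b * b = a + rscal e &
    forall z, z * a = a * z -> z * b = b * z].
Proof.
move=> sa h e0.
have sa' : selfadjoint (a - rscal t).
  by rewrite -rmorphN; exact: selfadjoint_shift.
have [|b [sb bb bc]] := sqrt_shift hN (s := t + e) sa'; first by lra.
exists b; split=> //; first by rewrite bb rmorphD addrA subrK.
by move=> z hz; apply: bc; rewrite mulrBr mulrBl hz rscalC.
Qed.

(** The commutation property, absent from [positive_is_square], is what makes the
    roots of two commuting elements commute. *)
Lemma positive_sqrt a e : positive a -> 0 < e ->
  exists b, [/\ selfadjoint b, b * b = a + rscal e &
    forall z, z * a = a * z -> z * b = b * z].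
Proof.
move=> pa; have [sa _] := pa; apply: (@sqrt_of_cnorm_sub _ (cnorm a + 1)) => //.
by apply: positive_cnorm_sub => //; rewrite ltrDl.
Qed.

Lemma positiveD a b : positive a -> positive b -> positive (a + b).
Proof.
move=> pa pb; have [[sa _] [sb _]] := (pa, pb).
apply: is_squares_positive => // e e0.
have [||c [sc cc _]] := @sqrt_of_cnorm_sub (a + b)
    ((cnorm a + 1) + (cnorm b + 1)) e _ _ e0; last by exists c.
- by rewrite /selfadjoint starD sa sb.
rewrite rmorphD opprD addrACA; apply: le_trans (bnormD hN _ _) _.
by apply: lerD; apply: positive_cnorm_sub; rewrite // ltrDl.
Qed.

(** Up to a small [e], [a = d^2] and [t - a = f^2] with commuting roots, and
    [cnorm_sq_le_sum] applies to [d^2 + f^2 = t]. *)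
Lemma positive_cnorm_le a t : 0 <= t -> positive a -> positive (rscal t - a) ->
  cnorm a <= t.
Proof.
move=> t0 pa pta; apply/ler_addgt0Pr => e e0.
have e3 : 0 < e / 3 by rewrite divr_gt0.
have [d [sd dd dc]] := positive_sqrt pa e3.
have [f [sf ff fc]] := positive_sqrt pta e3.
have df : d * f = f * d.
  apply: fc; have := dc a erefl; rewrite mulrBr mulrBl rscalC.
  by move=> ->.
have := cnorm_sq_le_sum sd sf df.
have -> : d * d + f * f = rscal (t + e / 3 + e / 3).
  rewrite dd ff !rmorphD; ncring.
move=> h; have {h} := le_trans h (cnorm_rscal _).
rewrite ger0_norm; last by lra.
have := bnormM hN d d; rewrite dd => h1 h2.
have := bnormB hN (a + rscal (e / 3)) (rscal (e / 3)); rewrite addrK => h3.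
have := cnorm_rscal (e / 3); rewrite gtr0_norm // => h4.
lra.
Qed.

(** By descent it suffices to bound the inverse [r] of [b^2 = star x x + s].
    Put [z = x b^-1], so that [star z z = 1 - s r <= 1]. The spectra of
    [star z z] and [z star z] agree off zero, so [z star z <= 1] too. As
    [z star z + star z z >= 0], one gets [star z z >= -1], that is
    [s r <= 2]. *)
Lemma positive_star_mul x : positive (star x * x).
Proof.
set a := star x * x.
have sa : selfadjoint a by rewrite /selfadjoint starM starK.
apply: is_squares_positive => //; apply: (sqrt_descent hN sa) => m m0 hm.
exists (2 / m), 1; split=> // s /andP[ms _].
have s0 := lt_trans m0 ms.
have [b sb bb] := hm s ms.
have ia : invertible (a + rscal s).
  have h : m < (s + m) / 2 by lra.
  have [c sc cc] := hm _ h.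
  have -> : a + rscal s = c * c + rscal ((s - m) / 2).
    by rewrite cc -addrA -rmorphD; congr (_ + rscal _); field.
  by apply: symA => //; lra.
have [r [hr hl]] := ia; exists r; split=> //.
have sr := star_inv (selfadjoint_shift s sa) hr hl.
have br : b * r = r * b.
  rewrite -[LHS]mul1r -hl -mulrA (mulrA (a + _)) -bb -(mulrA b b b) bb.
  by rewrite -(mulrA b) hr mulr1.
have brb : b * (r * b) = 1 by rewrite -br mulrA bb.
have aE : a = b * b - rscal s by rewrite bb addrK.
(* b * r is the inverse of b. *)
pose z := x * (b * r).
have zz : star z * z = 1 - rscal s * r.
  rewrite /z !starM sr sb.
  have -> : r * b * star x * (x * (b * r)) = r * (b * a * b) * r.
    rewrite /a; ncring.
  have -> : r * (b * a * b) * r =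
      (r * (b * b)) * ((b * b) * r) - rscal s * ((r * b) * (b * r)).
    rewrite aE mulrBr -(rscalC _ b) mulrBl mulrBr mulrBl; congr (_ - _).
      ncring.
    by rewrite -!mulrA [LHS]mulrA -rscalC -mulrA.
  by rewrite bb hl hr mulr1 -(mulrA r b) (mulrA b) bb hr mulr1.
have zz' : z * star z = x * r * star x.
  rewrite /z !starM sr sb br.
  have -> : x * (r * b) * (r * b * star x) = x * (r * (b * (r * b))) * star x.
    ncring.
  by rewrite brb mulr1.
have p1 : positive (1 - z * star z).
  have szz : selfadjoint (1 - z * star z).
    by rewrite /selfadjoint starB star1 starM starK.
  apply: symmetric_positive => // l l0.
  have -> : 1 - z * star z + rscal l = rscal (1 + l) - z * star z.
    by rewrite rmorphD rmorph1; ncring.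
  apply: invertible_jacobson_shift; first by rewrite gt_eqF // addr_gt0.
  have -> : rscal (1 + l) - star z * z =
      r * (rscal l * (b * b + rscal (s / l))).
    rewrite zz mulrDr -rmorphM mulrC divfK ?gt_eqF // mulrDr -!rscalC bb.
    rewrite mulrA -rscalC -mulrA hl mulr1 rmorphD rmorph1; ncring.
  apply: invertibleM; first by exists (a + rscal s).
  apply: invertible_scale; rewrite ?gt_eqF //.
  by apply: symA; rewrite // divr_gt0.
(* Twice this element is the sum of the squares of z + star z and
   i (z - star z). *)
have p2 : positive (z * star z + star z * z).
  pose p := z + star z; pose q := iscal * (z - star z).
  have sp : selfadjoint p by rewrite /selfadjoint starD starK addrC.
  have sq : selfadjoint q.
    rewrite /selfadjoint /q starM star_iscal starB starK.
    by rewrite mulrN -mulNr opprB -iscalC.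
  have : positive (rscal 2^-1 * (p * p + q * q)).
    apply: positive_scale; rewrite ?invr_gt0 //.
    by apply: positiveD; exact: square_positive.
  have -> : q * q = - ((z - star z) * (z - star z)).
    by rewrite /q {1}iscalC -mulrA (mulrA iscal) iscal_sq mulN1r mulrN.
  have -> : p * p - (z - star z) * (z - star z) =
      (z * star z + star z * z) + (z * star z + star z * z).
    by rewrite /p; ncring.
  by rewrite rscal_half.
have p3 : positive (rscal 2 - rscal s * r).
  have := positiveD p1 p2; rewrite zz.
  have -> : 1 - z * star z + (z * star z + (1 - rscal s * r)) =
      rscal 2 - rscal s * r.
    by rewrite rmorph_nat mulr2n; ncring.
  by [].
have p4 : positive (rscal s * r).
  apply: positive_scale => //.
  have -> : r = (b * r) * (b * r).
    by rewrite {1}br mulrA -(mulrA r) bb hl mul1r.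
  by apply: square_positive; rewrite // /selfadjoint starM sb sr br.
have := positive_cnorm_le (ler0n _ 2) p4 p3.
rewrite (bnormZr hN) gtr0_norm // => h.
have nr := bnorm_ge0 hN r.
by rewrite ler_pdivlMr //; nra.
Qed.

Lemma positive_sum (I : finType) (x : I -> A) : (forall i, positive (x i)) ->
  positive (\sum_i x i).
Proof.
by move=> px; elim/big_ind: _ => //; [exact: positive0|exact: positiveD].
Qed.

End CStar.

(** * Matrices over a C*-algebra *)

Section MatrixStar.
Variables (R : realType) (A : starAlgType R[i]).

Definition mxstar m n (X : 'M[A]_(m, n)) : 'M[A]_(n, m) :=
  \matrix_(i, j) star (X j i).

Lemma mxstarK m n : cancel (@mxstar m n) (@mxstar n m).
Proof. by move=> X; apply/matrixP => i j; rewrite !mxE starK. Qed.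

Lemma mxstarM m n p (X : 'M[A]_(m, n)) (Y : 'M[A]_(n, p)) :
  mxstar (X *m Y) = mxstar Y *m mxstar X.
Proof.
apply/matrixP => i j; rewrite !mxE (big_morph _ (@starD _ A) (star0 A)).
by apply: eq_bigr => k _; rewrite starM !mxE.
Qed.

Lemma mxstar_gram_col m n p (X : 'M[A]_(m, p)) (Y : 'M[A]_(n, p)) :
  mxstar (col_mx X Y) *m col_mx X Y = mxstar X *m X + mxstar Y *m Y.
Proof.
rewrite -mul_row_col; congr (_ *m _).
by apply/matrixP => i j; rewrite !mxE; case: splitP => k _; rewrite !mxE.
Qed.

Lemma invertible_mx_jacobson p q (P : 'M[A]_(p, q)) (Q : 'M[A]_(q, p)) :
  invertible (1 + P *m Q) -> invertible (1 + Q *m P).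
Proof.
move=> [C [hr hl]].
have {}hr : C + P *m Q *m C = 1%:M by rewrite -[RHS]hr -mulmxE mulmxDl mul1mx.
have {}hl : C + C *m P *m Q = 1%:M.
  by rewrite -[RHS]hl -mulmxE mulmxDr mulmx1 mulmxA.
exists (1 - Q *m C *m P); split; rewrite -mulmxE.
  have e : Q *m P *m (1 - Q *m C *m P) = Q *m C *m P.
    rewrite mulmxBr mulmx1 -!mulmxA -mulmxBr.
    by rewrite -{1}[P]mul1mx -hr mulmxDl !mulmxA addrK mulmxA.
  by rewrite mulmxDl mul1mx e subrK.
rewrite mulmxBl mul1mx mulmxDr mulmx1.
have -> : Q *m C *m P + Q *m C *m P *m (Q *m P) = Q *m P.
  by rewrite -!mulmxA -mulmxDr !mulmxA -mulmxDl hl mul1mx.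
by rewrite addrK.
Qed.

Lemma invertible_mx11 (X : 'M[A]_1) : invertible X <-> invertible (X 0 0).
Proof.
have e (Y : 'M[A]_1) : Y = (Y 0 0)%:M.
  by apply/matrixP => i j; rewrite !ord1 mxE mulr1n.
split=> [[Y [h1 h2]]|[y [h1 h2]]].
  exists (Y 0 0); split.
    by move/matrixP/(_ 0 0): h1; rewrite !mxE big_ord1 mulr1n.
  by move/matrixP/(_ 0 0): h2; rewrite !mxE big_ord1 mulr1n.
by exists y%:M; rewrite [X]e -!mulmxE -!scalar_mxM h1 h2.
Qed.

Lemma rscal_mx n (t : R) : rscal t = (rscal t)%:M :> 'M[A]_n.
Proof. by []. Qed.

Lemma scalar_rscalC m n (X : 'M[A]_(m, n)) (t : R) :
  X *m (rscal t)%:M = (rscal t)%:M *m X.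
Proof.
apply/matrixP => i j; rewrite mul_scalar_mx !mxE (bigD1 j) //= !mxE eqxx mulr1n.
rewrite big1 ?addr0 ?rscalC // => k /negPf kj.
by rewrite !mxE kj mulr0n mulr0.
Qed.

Lemma mx11_shift (X : 'M[A]_1) (s : R) : (X + rscal s) 0 0 = X 0 0 + rscal s.
Proof. by rewrite !mxE mulr1n. Qed.

End MatrixStar.

Section MatrixNorm.
Variables (R : realType) (A : starAlgType R[i]) (N : A -> R).
Hypothesis hN : banach_star_norm N.
Variable n : nat.

Definition mxnorm (X : 'M[A]_n) : R := \sum_i \sum_j N (X i j).

Lemma le_mxnorm (X : 'M[A]_n) i j : N (X i j) <= mxnorm X.
Proof.
have h k : 0 <= \sum_l N (X k l).
  by apply: sumr_ge0 => l _; exact: bnorm_ge0 hN _.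
rewrite /mxnorm (bigD1 i) //= (bigD1 j) //= -addrA lerDl addr_ge0 //.
  by apply: sumr_ge0 => l _; exact: bnorm_ge0 hN _.
exact: sumr_ge0.
Qed.

Lemma mxnorm_banach : banach_star_norm mxnorm.
Proof.
split.
- move=> X Y; rewrite /mxnorm -big_split /=; apply: ler_sum => i _.
  rewrite -big_split /=; apply: ler_sum => j _; rewrite mxE.
  exact: bnormD hN _ _.
- move=> l X; rewrite /mxnorm mulr_sumr; apply: eq_bigr => i _.
  rewrite mulr_sumr; apply: eq_bigr => j _; rewrite -(bnormZ hN).
  by rewrite -mulmxE mul_scalar_mx mxE.
- move=> X X0; apply/matrixP => i j; rewrite mxE; apply: (bnorm0_eq0 hN).
  by apply/eqP; rewrite eq_le (bnorm_ge0 hN) andbT -X0 le_mxnorm.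
- move=> X Y; rewrite /mxnorm mulr_suml; apply: ler_sum => i _.
  rewrite mulr_suml.
  apply: (@le_trans _ _ (\sum_j \sum_k N (X i k) * N (Y k j))).
    apply: ler_sum => j _; rewrite mxE.
    apply: le_trans (_ : \sum_k N (X i k * Y k j) <= _).
      elim/big_ind2: _ => [|u x v y hu hv|//]; first by rewrite (bnorm0 hN).
      by apply: le_trans (bnormD hN _ _) _; exact: lerD.
    by apply: ler_sum => k _; exact: bnormM hN _ _.
  rewrite exchange_big /=; apply: ler_sum => k _.
  rewrite -mulr_sumr ler_wpM2l ?(bnorm_ge0 hN) //.
  rewrite [leRHS](bigD1 k) //= lerDl; apply: sumr_ge0 => l _.
  by apply: sumr_ge0 => j _; exact: bnorm_ge0 hN _.
- move=> X; rewrite /mxnorm exchange_big /=; apply: eq_bigr => i _.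
  by apply: eq_bigr => j _; rewrite mxE (bnorm_star hN).
- move=> u cu.
  have /choice[L hL] (ij : 'I_n * 'I_n) : exists l : A, forall e : R, 0 < e ->
      exists K, forall k : nat, (K <= k)%N -> N (u k ij.1 ij.2 - l) < e.
    apply: (bnorm_complete hN) => e /cu[K hK]; exists K => p q hp hq.
    by apply: le_lt_trans (hK p q hp hq); rewrite -[leRHS]/(mxnorm _)
      (le_trans _ (le_mxnorm _ ij.1 ij.2)) // !mxE.
  exists (\matrix_(i, j) L (i, j)) => e e0.
  pose d := e / (n * n).+1%:R.
  have d0 : 0 < d by rewrite divr_gt0.
  have /choice[K hK] (ij : 'I_n * 'I_n) : exists K, forall k : nat,
      (K <= k)%N -> N (u k ij.1 ij.2 - L ij) < d by exact: hL.
  exists (\max_ij K ij)%N => k hk.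
  apply: (@le_lt_trans _ _ (\sum_(i < n) \sum_(j < n) d)).
    apply: ler_sum => i _; apply: ler_sum => j _; rewrite !mxE ltW //.
    by apply: (hK (i, j)); apply: leq_trans hk; exact: leq_bigmax.
  rewrite !sumr_const !card_ord -mulrnA -mulr_natr /d mulrAC ltr_pdivrMr //.
  by rewrite ltr_pM2l // ltr_nat.
Qed.

End MatrixNorm.

Section MatrixPositivity.
Variables (R : realType) (A : cstarAlgType R).

(** Induction on the rows. If [W = 1 + star Z Z] has inverse [V], then
    [W + star y y = W (1 + V (star y) y)], and Jacobson's trick moves the
    question to the scalar [1 + y V (star y)]. With [w = V (star y)] this scalar
    is [1 + star w W w = 1 + star w w + star (Z w) (Z w)], one plus a sum of
    elements [star x x] of [A]. *)
Lemma invertible_gram m n (Y : 'M[A]_(m, n)) : invertible (1 + mxstar Y *m Y).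
Proof.
elim: m Y => [|m IH] Y.
  exists 1; suff -> : mxstar Y *m Y = 0 by rewrite addr0 mulr1.
  by apply/matrixP => i j; rewrite !mxE big_ord0.
rewrite -[m.+1]/(1 + m)%N in Y *; rewrite -[Y]vsubmxK.
set y : 'rV_n := usubmx Y; set Z : 'M_(m, n) := dsubmx Y.
have [V [hr hl]] := IH Z; set W := 1 + _ in hr hl.
have sW : star W = W.
  rewrite /W starD star1; congr (_ + _).
  by rewrite -[LHS]/(mxstar _) mxstarM mxstarK.
have sV : mxstar V = V := star_inv sW hr hl.
rewrite mxstar_gram_col addrCA addrC -/W.
have -> : W + mxstar y *m y = W * (1 + (V *m mxstar y) *m y).
  by rewrite mulrDr mulr1 -!mulmxE !mulmxA [W *m V]hr mul1mx.
apply: invertibleM; first by exists V.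
apply: invertible_mx_jacobson; apply/invertible_mx11.
pose w := V *m mxstar y; pose u := col_mx w (Z *m w).
have -> : y *m w = mxstar u *m u.
  have Ww : w + mxstar Z *m (Z *m w) = mxstar y.
    by rewrite mulmxA -{1}[w]mul1mx -mulmxDl mulmxA [_ *m V]hr mul1mx.
  rewrite mxstar_gram_col (mxstarM Z w) -(mulmxA (mxstar w)) -mulmxDr Ww.
  by rewrite /w mxstarM mxstarK sV mulmxA.
rewrite !mxE mulr1n addrC -[1]/(1%:R) -(rmorph1 (@rscal R A)).
apply: positive_invertible => //; apply: positive_sum => i.
by rewrite !mxE; exact: positive_star_mul.
Qed.

Lemma invertible_gram_shift m n (Y : 'M[A]_(m, n)) (s : R) : 0 < s ->
  invertible (mxstar Y *m Y + rscal s).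
Proof.
move=> s0; pose r := Num.sqrt s.
have r0 : r != 0 by rewrite gt_eqF // sqrtr_gt0.
have rr : r * r = s by rewrite -expr2 sqr_sqrtr // ltW.
have [Z Y_E] : exists Z, Y = (rscal r)%:M *m Z.
  exists ((rscal r^-1)%:M *m Y).
  by rewrite mulmxA -scalar_mxM -rmorphM mulfV // rmorph1 mul1mx.
have -> : mxstar Y *m Y + rscal s = rscal s * (1 + mxstar Z *m Z).
  rewrite mulrDr mulr1 addrC; congr (_ + _); rewrite Y_E mxstarM.
  have -> : mxstar (rscal r)%:M = (rscal r)%:M :> 'M[A]_m := star_rscal _ r.
  rewrite -rr rscal_mx rmorphM scalar_mxM -!mulmxE scalar_rscalC !mulmxA.
  by rewrite -(mulmxA _ (mxstar Z)) scalar_rscalC !mulmxA.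
by apply: invertible_scale; rewrite ?gt_eqF //; exact: invertible_gram.
Qed.

Lemma mx_symmetric n : star_symmetric 'M[A]_n.
Proof.
move=> X s sX s0; rewrite -{1}sX; exact: (invertible_gram_shift X s0).
Qed.

Lemma mx_positive_sqrt n (P : 'M[A]_n) (s : R) :
  positive P -> 0 < s -> is_square (P + rscal s).
Proof. exact: (positive_is_square (mxnorm_banach (cnorm_banach A) n)). Qed.

Lemma is_square_gram n (P : 'M[A]_n) :
  is_square P -> exists Z : 'M[A]_n, mxstar Z *m Z = P.
Proof. by move=> [Z sZ ZZ]; exists Z; rewrite -ZZ -[X in _ = X * _]sZ. Qed.

(** With approximate roots [Z] and [W] of [P] and [Q], the sum is approximately
    the Gram matrix of [col_mx Z W]. *)
Lemma mx_positiveD n (P Q : 'M[A]_n) :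
  positive P -> positive Q -> positive (P + Q).
Proof.
move=> pP pQ; have [[sP _] [sQ _]] := (pP, pQ).
apply: symmetric_positive; first exact: mx_symmetric.
  by rewrite /selfadjoint starD sP sQ.
move=> s s0; have s3 : 0 < s / 3 by rewrite divr_gt0.
have [Z ZE] := is_square_gram (mx_positive_sqrt pP s3).
have [W WE] := is_square_gram (mx_positive_sqrt pQ s3).
have -> : P + Q + rscal s = mxstar (col_mx Z W) *m col_mx Z W + rscal (s / 3).
  rewrite mxstar_gram_col ZE WE.
  have {1}-> : s = s / 3 + s / 3 + s / 3 by field.
  by rewrite !rmorphD !addrA [P + Q + _]addrAC.
exact: invertible_gram_shift.
Qed.

(** Replacing [P] by [P + e = star Z Z] changes [star V P V] by [e star V V].
    For small [e] this error is absorbed by [s / 2], since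
    [s / 2 - e star V V] is itself a square. *)
Lemma mx_positive_sandwich m n (P : 'M[A]_m) (V : 'M[A]_(m, n)) :
  positive P -> positive (mxstar V *m P *m V).
Proof.
move=> pP; have [sP _] := pP; pose G := mxstar V *m V.
have sG : selfadjoint G.
  by rewrite /selfadjoint -[LHS]/(mxstar _) mxstarM mxstarK.
apply: symmetric_positive; first exact: mx_symmetric.
  rewrite /selfadjoint -[LHS]/(mxstar _) !mxstarM mxstarK.
  by rewrite -[mxstar P]/(star P) sP mulmxA.
move=> s s0.
pose N := mxnorm (@cnorm R A) (n := n).
have hN : banach_star_norm N := mxnorm_banach (cnorm_banach A) n.
have g0 := bnorm_ge0 hN G.
pose e := s / 2 / (N G + 1).
have e0 : 0 < e by rewrite !divr_gt0 // ltr_wpDl.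
have eG : e * N G < s / 2.
  have : e * (N G + 1) = s / 2 by rewrite divfK // gt_eqF // ltr_wpDl.
  lra.
have [Z ZE] := is_square_gram (mx_positive_sqrt pP e0).
have [W WE] : exists W : 'M_n, mxstar W *m W = - (rscal e * G) + rscal (s / 2).
  apply/is_square_gram/(is_square_shift hN).
    by rewrite /selfadjoint starN starM star_rscal sG rscalC.
  by rewrite (bnormN hN) (bnormZr hN) gtr0_norm.
have -> : mxstar V *m P *m V + rscal s =
    mxstar (col_mx (Z *m V) W) *m col_mx (Z *m V) W + rscal (s / 2).
  rewrite mxstar_gram_col WE mxstarM !mulmxA -(mulmxA (mxstar V) (mxstar Z)) ZE.
  rewrite mulmxDr mulmxDl [rscal e]rscal_mx scalar_rscalC.
  rewrite -(mulmxA _ (mxstar V)) -/G -[_ *m G]/(rscal e * G).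
  by rewrite {1}[s]splitr rmorphD !addrA addrK.
by apply: invertible_gram_shift; rewrite divr_gt0.
Qed.

Lemma positive_mx11 (P : 'M[A]_1) : positive P <-> positive (P 0 0).
Proof.
split=> pP; have [sP _] := pP.
  apply: symmetric_positive; first exact: cstar_symmetric.
    by move/matrixP/(_ 0 0): sP; rewrite mxE.
  move=> s s0; rewrite -mx11_shift; apply/invertible_mx11.
  exact: positive_invertible.
apply: symmetric_positive; first exact: mx_symmetric.
  by apply/matrixP => i j; rewrite !ord1 mxE.
move=> s s0; apply/invertible_mx11; rewrite mx11_shift.
exact: positive_invertible.
Qed.

End MatrixPositivity.

(** * The superadditivity inequality *)

Section Superadditivity.
Variables (R : realType) (A B : cstarAlgType R).

Definition test_row (k : 'I_3) : 'rV[A]_3 := \row_j (j != k)%:R.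

Definition test_mx (a b : A) : 'M[A]_3 :=
  mxstar (test_row 2) *m a%:M *m test_row 2 +
  mxstar (test_row 1) *m b%:M *m test_row 1.

Lemma test_mx_positive a b : positive a -> positive b -> positive (test_mx a b).
Proof.
move=> pa pb; apply: mx_positiveD; apply: mx_positive_sandwich.
  by apply/positive_mx11; rewrite mxE mulr1n.
by apply/positive_mx11; rewrite mxE mulr1n.
Qed.

Lemma test_mxE a b i j : test_mx a b i j =
  a *+ ((i != 2) && (j != 2)) + b *+ ((i != 1) && (j != 1)).
Proof.
have star_bool (t : bool) : star (t%:R : A) = t%:R.
  by case: t; rewrite ?star1 ?star0.
have e k (x : A) : (mxstar (test_row k) *m x%:M *m test_row k) i j =
    x *+ ((i != k) && (j != k)).
  rewrite -mulmxA mul_scalar_mx mxE big_ord1 !mxE star_bool.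
  by case: (i != k); case: (j != k); rewrite ?mul1r ?mulr1 ?mulr0 ?mul0r.
by rewrite mxE !e.
Qed.

Lemma positive_entry_star n (Y : 'M[B]_n) i j :
  positive Y -> star (Y i j) = Y j i.
Proof. by move=> [/matrixP/(_ j i) + _]; rewrite mxE. Qed.

Variables (Phi : A -> B) (hPhi : n_positive 3 Phi).

Lemma superadditive_defect a b : positive a -> positive b ->
  sa_le (Phi a + Phi b) (2%:R * Phi 0 + Phi (a + b)).
Proof.
move=> pa pb.
have [Y pY Yij] : exists2 Y : 'M[B]_3, positive Y & forall i j, Y i j =
    Phi (a *+ ((i != 2) && (j != 2)) + b *+ ((i != 1) && (j != 1))).
  exists (map_mx Phi (test_mx a b)); first exact/hPhi/test_mx_positive.
  by move=> i j; rewrite mxE test_mxE.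
have sY i j := positive_entry_star i j pY.
have [s0 [sa [sb sab]]] : selfadjoint (Phi 0) /\ selfadjoint (Phi a) /\
    selfadjoint (Phi b) /\ selfadjoint (Phi (a + b)).
  have := (sY 1 2, sY 1 1, sY 2 2, sY 0 0).
  by rewrite !Yij /= !mulr0n !mulr1n !addr0 !add0r => -[[[]]].
split.
- by rewrite /selfadjoint starD sa sb.
- by rewrite /selfadjoint starD mulr2n mulrDl mul1r starD s0 sab.
pose c : 'cV[B]_3 := \col_i (if i == 0 then 1 else -1).
have := mx_positive_sandwich c pY => /positive_mx11.
suff -> : (mxstar c *m Y *m c) 0 0 =
    2%:R * Phi 0 + Phi (a + b) - (Phi a + Phi b) by [].
rewrite mxE !big_ord_recl big_ord0 !mxE !big_ord_recl !big_ord0 !mxE.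
rewrite !Yij /= !mulr0n !mulr1n !addr0 !add0r.
rewrite !starN !star1 !mulr2n.
ncring.
Qed.

End Superadditivity.

Theorem theorem3p5 (R : realType) (A B : cstarAlgType R) (Phi : A -> B)
    (hPhi : n_positive 3 Phi) :
  (forall a b : A, positive a -> positive b ->
     sa_le (Phi a + Phi b) (2%:R * Phi 0 + Phi (a + b))) /\
  (Phi 0 = 0 <->
   forall a b : A, positive a -> positive b ->
     sa_le (Phi a + Phi b) (Phi (a + b))).
Proof.
have main := superadditive_defect hPhi; split=> //; split=> [Phi0 a b pa pb|h].
  by have := main a b pa pb; rewrite Phi0 mulr0 add0r.
have p0 := positive0 (@cstar_symmetric R A).
have neg : positive (- Phi 0).
  by have [_ _] := h 0 0 p0 p0; rewrite addr0 opprD addrA subrr add0r.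
have pos : positive (Phi 0).
  have p3 : positive (0 : 'M[A]_3) := positive0 (@mx_symmetric R A 3).
  have := mx_positive_sandwich (delta_mx 0 0 : 'cV[B]_3) (hPhi _ p3).
  move/positive_mx11; rewrite !mxE !big_ord_recl big_ord0.
  rewrite !mxE !big_ord_recl !big_ord0 !mxE /=.
  by rewrite !star1 !star0 !mul0r !mul1r !mulr1 !mulr0 !addr0.
apply: cnorm0_eq0; apply/eqP.
rewrite eq_le (bnorm_ge0 (cnorm_banach B)) andbT.
by apply: positive_cnorm_le => //; rewrite rmorph0 sub0r.
Qed.
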